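(* Let $f:\,]0,\infty[\to\mathbb{R}$ be a strictly convex function with $f(x)\geq 0$ for all $x$, $f(1)=0$ and $f'(\infty)=\infty$. Let $C\subseteq M_{+}^{1}$ be a convex set of probability measures and let $Q\in M_{+}^{1}$ be a probability measure with $D_{f}(C,Q)<\infty$. Then the projection $Q^{*}$ of $Q$ on $C$ is a unique probability measure; that is, there exists a unique probability measure $Q^{*}$ such that for every asymptotically optimal sequence $(P_{n})$ in $C$ we have $P_{n}(i)\to Q^{*}(i)$ as $n\to\infty$ for $Q$-almost every $i$.
   Context: All measures live on a fixed countable (discrete) set; a measure $P$ is identified with its vector of point masses $p_i=P(i)\geq 0$. $M_{+}^{1}$ denotes the set of probability measures on this set. For a convex $f:\,]0,\infty[\to\mathbb{R}$ with $f\geq 0$ and $f(1)=0$, set $f(0)=\lim_{x\to 0}f(x)$ and $f'(\infty)=\lim_{x\to\infty}f(x)/x$ (both in $[0,\infty]$), with the convention $f\left(\frac{x}{0}\right)\cdot 0=f'(\infty)\cdot x$ (equal to $0$ when $x=0$). For finite measures $P,Q$ the $f$-divergence is $D_{f}(P,Q)=\sum_{i}f\left(\frac{p_{i}}{q_{i}}\right)q_{i}\in[0,\infty]$. For a convex set $C$ of measures, $D_{f}(C,Q)=\inf_{P\in C}D_{f}(P,Q)$. A sequence $P_{n}\in C$ is asymptotically optimal if $D_{f}(P_{n},Q)\to D_{f}(C,Q)$ as $n\to\infty$. The projection of $Q$ on $C$ is the measure $Q^{*}$ that is the $Q$-almost everywhere pointwise limit of every asymptotically optimal sequence. *)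

(* Defs.v *)
From HB Require Import structures.
From mathcomp Require Import all_boot all_order all_algebra.
From mathcomp Require Import all_classical all_reals all_analysis.

Set Implicit Arguments.
Unset Strict Implicit.
Unset Printing Implicit Defensive.
Import Order.TTheory GRing.Theory Num.Theory.
Import numFieldNormedType.Exports.

Local Open Scope classical_set_scope.
Local Open Scope ring_scope.
Local Open Scope ereal_scope.

(** A function on the open half-line is a total [f : R -> R] of which only the
    values at positive reals are ever used: here, and in the one-sided limit at
    0 and the limit at infinity below. *)
Definition strictly_convex_pos (R : realType) (f : R -> R) : Prop :=
  forall x y t : R, (0 < x -> 0 < y -> x != y -> 0 < t < 1 ->
    f (t * x + (1 - t) * y) < t * f x + (1 - t) * f y)%R.

Definition f_at0 (R : realType) (f : R -> R) : \bar R :=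
  lim ((f x)%:E @[x --> (0%R : R)^'+]).

Definition fprime_infty (R : realType) (f : R -> R) : \bar R :=
  lim ((f x / x)%:E @[x --> +oo%R]).

Definition f_ext (R : realType) (f : R -> R) (x : R) : \bar R :=
  if x == 0%R then f_at0 f else (f x)%:E.

(** [f (p / q) q].  For [q = 0] this is [f'(oo) p], and the library's
    [+oo * 0 = 0] gives the value 0 when moreover [p = 0]. *)
Definition divergence_term (R : realType) (f : R -> R) (p q : R) : \bar R :=
  if q == 0%R then fprime_infty f * p%:E else f_ext f (p / q)%R * q%:E.

(** On a countable space in which every set is measurable, a measure [P] is
    determined by its point masses [P [set i]]. *)
Definition discrete_countable d (T : measurableType d) : Prop :=
  countable [set: T] /\ forall A : set T, measurable A.

Section divergence.
Context d (T : measurableType d) (R : realType) (f : R -> R).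

(** [\esum] is the sum of nonnegative terms, hence the intended value as soon
    as [f >= 0]. *)
Definition fdivergence (P Q : {finite_measure set T -> \bar R}) : \bar R :=
  \esum_(i in [set: T]) divergence_term f (fine (P [set i])) (fine (Q [set i])).

Definition fdivergence_set (C : set (probability T R))
    (Q : {finite_measure set T -> \bar R}) : \bar R :=
  ereal_inf [set fdivergence P Q | P in C].

Definition asymptotically_optimal (C : set (probability T R))
    (Q : {finite_measure set T -> \bar R})
    (P_ : nat -> probability T R) : Prop :=
  (forall n, C (P_ n)) /\
  fdivergence (P_ n) Q @[n --> \oo] --> fdivergence_set C Q.

Definition is_projection (C : set (probability T R))
    (Q : {finite_measure set T -> \bar R})
    (Qstar : {measure set T -> \bar R}) : Prop :=
  forall P_ : nat -> probability T R, asymptotically_optimal C Q P_ ->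
    {ae Q, forall i, P_ n [set i] @[n --> \oo] --> Qstar [set i]}.

End divergence.

(** [probability T R] is not a convex space of the library; the convex
    combination is taken set by set. *)
Definition convex_probabilities d (T : measurableType d) (R : realType)
    (C : set (probability T R)) : Prop :=
  forall (P1 P2 : probability T R) (t : R), C P1 -> C P2 -> (0 <= t <= 1)%R ->
    exists2 P : probability T R, C P &
      forall A, measurable A -> P A = t%:E * P1 A + (1 - t)%:E * P2 A.

(* Main.v *)
(* Two nearly optimal members of C have a midpoint in C, whose divergence is at
   least the infimum; so the midpoint convexity gap of f at the two densities is
   small at every point of positive Q-mass. Strict convexity bounds this gap from
   below when the densities, which lie in [0, 1 / Q(i)], are far apart. Hence every
   asymptotically optimal sequence is pointwise Cauchy, with a common limit. Since
   f'(oo) = oo, bounded divergence gives K P(A) <= M Q(A) + D(P, Q), so no mass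
   escapes to infinity and the limit has total mass 1. *)
Require Import Defs.
From HB Require Import structures.
From mathcomp Require Import all_boot all_order all_algebra.
From mathcomp Require Import all_classical all_reals all_analysis.
From mathcomp Require Import ring lra.
Import Order.TTheory GRing.Theory Num.Theory.
Import numFieldNormedType.Exports.
Local Open Scope classical_set_scope.
Local Open Scope ring_scope.

(** * Midpoint gaps of convex functions of one real variable *)

(* The threshold [a] is 0 when [f(0)] is finite, and positive otherwise: then
   [f] is real-valued only away from 0. *)
Definition chord_convex_from (R : realFieldType) (a : R) (g : R -> R) : Prop :=
  forall x z y, a <= x -> x <= z -> z <= y ->
    (y - x) * g z <= (y - z) * g x + (z - x) * g y.

Lemma chord_convex_midpoint (R : realFieldType) (a : R) (g : R -> R) (x y : R) :
  chord_convex_from R a g -> a <= x -> x <= y ->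
  g ((x + y) / 2) + g ((x + y) / 2) <= g x + g y.
Proof.
move=> gc ax; rewrite le_eqVlt => /predU1P[<-|xy].
  by rewrite (_ : (x + x) / 2 = x)//; field.
have := gc x ((x + y) / 2) y ax ltac:(lra) ltac:(lra).
rewrite (_ : y - (x + y) / 2 = (y - x) * 2^-1); last by field.
rewrite (_ : (x + y) / 2 - x = (y - x) * 2^-1); last by field.
rewrite -!mulrA -mulrDr ler_pM2l ?subr_gt0//; lra.
Qed.

(* [y', m, m] is majorized by [y, m', m'], where [m], [m'] are the midpoints. *)
Lemma midpoint_gap_right (R : realFieldType) (a : R) (g : R -> R) (x y y' : R) :
  chord_convex_from R a g -> a <= x -> x < y' -> y' <= y ->
  g x + g y' - 2 * g ((x + y') / 2) <= g x + g y - 2 * g ((x + y) / 2).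
Proof.
move=> gc ax xy' y'y.
have := gc ((x + y') / 2) y' y ltac:(lra) ltac:(lra) ltac:(lra).
have := gc ((x + y') / 2) ((x + y) / 2) y ltac:(lra) ltac:(lra) ltac:(lra).
set m := (x + y) / 2; set m' := (x + y') / 2 => h1 h2.
have mE : 2 * m = x + y by rewrite /m; field.
have mE' : 2 * m' = x + y' by rewrite /m'; field.
have d0 : 0 < y - m' by lra.
suff : g y' + 2 * g m <= 2 * g m' + g y by lra.
(* Both chords run from [m'] to [y], so after multiplication by [y - m'] the claim is [h1] plus
   twice [h2]. *)
rewrite -(ler_pM2l d0); move: h1 h2.
rewrite (_ : y - m = y - m' - (y - y') / 2); last lra.
rewrite (_ : m - m' = (y - y') / 2); last lra.
lra.
Qed.

(** Mirror image: with [m], [m'] again the midpoints, [x'], [m], [m] is majorized by [x], [m'],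
    [m']. It is argued separately because convexity from a threshold [a] is not symmetric under
    reflection. *)
Lemma midpoint_gap_left (R : realFieldType) (a : R) (g : R -> R) (x x' y : R) :
  chord_convex_from R a g -> a <= x -> x <= x' -> x' < y ->
  g x' + g y - 2 * g ((x' + y) / 2) <= g x + g y - 2 * g ((x + y) / 2).
Proof.
move=> gc ax xx' x'y.
have := gc x x' ((x' + y) / 2) ltac:(lra) ltac:(lra) ltac:(lra).
have := gc x ((x + y) / 2) ((x' + y) / 2) ltac:(lra) ltac:(lra) ltac:(lra).
set m := (x + y) / 2; set m' := (x' + y) / 2 => h1 h2.
have mE : 2 * m = x + y by rewrite /m; field.
have mE' : 2 * m' = x' + y by rewrite /m'; field.
have d0 : 0 < m' - x by lra.
suff : g x' + 2 * g m <= 2 * g m' + g x by lra.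
rewrite -(ler_pM2l d0); move: h1 h2.
rewrite (_ : m' - m = (x' - x) / 2); last lra.
rewrite (_ : m - x = m' - x - (x' - x) / 2); last lra.
lra.
Qed.

Lemma midpoint_gap_incl (R : realFieldType) (a : R) (g : R -> R) (x x' y' y : R) :
  chord_convex_from R a g -> a <= x -> x <= x' -> x' < y' -> y' <= y ->
  g x' + g y' - 2 * g ((x' + y') / 2) <= g x + g y - 2 * g ((x + y) / 2).
Proof.
move=> gc ax xx' x'y' y'y.
apply: le_trans (midpoint_gap_left _ _ _ x x' y gc ax xx' _); last lra.
by apply: midpoint_gap_right gc _ _ _; lra.
Qed.

Lemma finite_lower_bound (R : realFieldType) (G : nat -> R) (N : nat) :
  (forall k, 0 < G k) -> exists2 a : R, 0 < a & forall k, (k < N)%N -> a <= G k.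
Proof.
move=> G0; elim: N => [|N [a a0 aG]]; first by exists 1.
exists (Num.min a (G N)); first by rewrite lt_min a0 G0.
move=> k; rewrite ltnS leq_eqVlt => /predU1P[->|kN].
  by rewrite ge_min lexx orbT.
by rewrite ge_min aG.
Qed.

(** * Convexity of [f] extended to the point 0 *)

Section strictly_convex.
Context (R : realType) (f : R -> R).
Context (f_strict : strictly_convex_pos f)
  (f_ge0 : forall x : R, 0 < x -> 0 <= f x) (f1 : f 1 = 0).

Let f_chord (x z y : R) : 0 < x -> x <= z -> z <= y ->
  (y - x) * f z <= (y - z) * f x + (z - x) * f y.
Proof.
move=> x0; rewrite le_eqVlt => /predU1P[<-|xz].
  by rewrite subrr mul0r addr0.
rewrite le_eqVlt => /predU1P[->|zy].
  by rewrite subrr mul0r add0r.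
have d0 : 0 < y - x by lra.
have dn : y - x != 0 by rewrite gt_eqF.
have := f_strict x y ((y - z) / (y - x)) x0 ltac:(lra) ltac:(by rewrite lt_eqF//; lra).
rewrite divr_gt0 ?ltr_pdivrMr ?mul1r//=; [|lra..].
have -> : 1 - (y - z) / (y - x) = (z - x) / (y - x) by field.
have -> : (y - z) / (y - x) * x + (z - x) / (y - x) * y = z by field.
move=> /(_ ltac:(lra)) /ltW; rewrite -(ler_pM2l d0) => /le_trans; apply.
rewrite le_eqVlt; apply/orP; left; apply/eqP; field; exact: dn.
Qed.

(** The chord from [x] to 1 ends at [f 1 = 0], so [f y] is at most [f x] times a factor in [0, 1].
    This monotonicity makes the limit at 0 exist. *)
Let f_noninc (x y : R) : 0 < x -> x <= y -> y <= 1 -> f y <= f x.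
Proof.
move=> x0 xy y1; have := f_chord x y 1 x0 xy y1.
rewrite f1 mulr0 addr0 => h.
have := f_ge0 x x0; have := f_ge0 y ltac:(lra) => fy fx.
have [y1'|/eqP y1'] := eqVneq y 1; first by rewrite y1' f1.
have d : 0 < 1 - x by move/eqP: y1' => y1'; rewrite subr_gt0 (le_lt_trans xy)// lt_neqAle y1' y1.
rewrite -(ler_pM2l d); apply: le_trans h _.
by apply: ler_wpM2r => //; lra.
Qed.

(** By monotonicity the right limit at 0 is the supremum of [f] over ]0, 1[. *)
Lemma f_at0_ge (x : R) : 0 < x -> x < 1 -> ((f x)%:E <= f_at0 f)%E.
Proof.
move=> x0 x1; rewrite /f_at0.
have h := @nonincreasing_at_right_cvge R (fun x => (f x)%:E) 0 (BLeft 1).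
rewrite (cvg_lim _ (h _ _)) //.
- by apply: ereal_sup_ubound; exists x => //=; rewrite in_itv/= x0 x1.
- by rewrite bnd_simp.
- move=> u v; rewrite !in_itv/= => /andP[u0 u1] /andP[v0 v1] uv.
  by rewrite lee_fin f_noninc// ltW.
Qed.

Lemma f_at0_ge0 : (0 <= f_at0 f)%E.
Proof.
apply: le_trans (f_at0_ge (1 / 2) _ _); [|lra..].
by rewrite lee_fin; apply: f_ge0; lra.
Qed.

Lemma f_ext_ge0 (x : R) : 0 <= x -> (0 <= f_ext f x)%E.
Proof.
rewrite le_eqVlt /f_ext => /predU1P[<-|x0]; first by rewrite eqxx f_at0_ge0.
by rewrite gt_eqF// lee_fin f_ge0.
Qed.

Lemma chord_convex_pos (a : R) : 0 < a -> chord_convex_from R a (fun x => fine (f_ext f x)).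
Proof.
move=> a0 x z y ax xz zy; rewrite /f_ext.
by rewrite !gt_eqF /=; [apply: f_chord|..]; lra.
Qed.

(** Convexity reaches the endpoint by moving 0 to a small [w > 0]: there [f w] is below the limit
    value, and what remains of the change is an arbitrarily small error. *)
Lemma chord_convex_0 : f_at0 f \is a fin_num ->
  chord_convex_from R 0 (fun x => fine (f_ext f x)).
Proof.
move=> fin x z y; rewrite le_eqVlt => /predU1P[<-|x0 xz zy]; last first.
  by rewrite /f_ext !gt_eqF /=; [apply: f_chord|..]; lra.
rewrite !subr0 le_eqVlt => /predU1P[<- _|z0 zy].
  by rewrite subr0 mul0r addr0.
rewrite /f_ext eqxx !gt_eqF /=; [|lra..].
set F0 := fine (f_at0 f).
have F0ge w : 0 < w -> w < 1 -> f w <= F0.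
  by move=> w0 w1; rewrite -lee_fin /F0 fineK// f_at0_ge.
have fz := f_ge0 z z0; have fy := f_ge0 y ltac:(lra).
apply/ler_addgt0Pr => e e0.
pose d := f z + 1; have d0 : 0 < d by rewrite /d; lra.
(* [e / d] keeps the error [w * f z] below [e], [1 / 2] gives [f w <= F0], and [z / 2] keeps [w] to
   the left of [z]. The 1 in [d] covers [f z = 0]. *)
pose w := Num.min (e / d) (Num.min (1 / 2) (z / 2)).
have ed : 0 < e / d by rewrite divr_gt0.
have w0 : 0 < w by rewrite /w !lt_min ed; apply/and3P; split; lra.
have we : w * d <= e by rewrite -ler_pdivlMr// /w ge_min lexx.
have wh : w <= 1 / 2 by rewrite /w !ge_min lexx !orbT.
have wz : w <= z / 2 by rewrite /w !ge_min lexx !orbT.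
have h := f_chord w z y w0 ltac:(lra) zy.
have h2 : (y - z) * f w <= (y - z) * F0 by apply: ler_wpM2l; [lra|apply: F0ge; lra].
have h3 : 0 <= w * f y by rewrite mulr_ge0// ltW.
have we' : w * f z + w <= e by move: we; rewrite /d mulrDr mulr1.
move: h h2 h3 we' w0; clearbody w F0; lra.
Qed.

(** Stated with sums because [f_at0 f] may be [+oo]. If it is and an argument is 0, the right-hand
    side is infinite; otherwise all values are real and chord convexity applies. *)
Lemma f_ext_midpoint_le (x y : R) : 0 <= x -> 0 <= y ->
  (f_ext f ((x + y) / 2) + f_ext f ((x + y) / 2) <= f_ext f x + f_ext f y)%E.
Proof.
wlog xy : x y / x <= y => [hw x0 y0|x0 _].
  have [xy|/ltW yx] := leP x y; first exact: hw.
  by rewrite (addrC x y) (addeC (f_ext f x)) hw.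
have [y0|y0] := leP y 0.
  have -> : x = 0 by lra. have -> : y = 0 by lra.
  by rewrite addr0 mul0r.
have fin z : 0 < z -> f_ext f z = (fine (f_ext f z))%:E.
  by move=> z0; rewrite /f_ext gt_eqF.
have m0 : 0 < (x + y) / 2 by lra.
rewrite (fin _ m0) (fin _ y0).
move: x0; rewrite le_eqVlt => /predU1P[<-|x0].
  have := f_at0_ge0; rewrite [f_ext f 0]/f_ext eqxx.
  case E : (f_at0 f) => [r| |]//= _; last by rewrite leey.
  have -> : r = fine (f_ext f 0) by rewrite /f_ext eqxx E.
  rewrite -!EFinD lee_fin; apply: (chord_convex_midpoint _ 0 (fun x => fine (f_ext f x))) => //.
    by apply: chord_convex_0; rewrite E.
  exact: ltW.
rewrite (fin _ x0) -!EFinD lee_fin.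
apply: (chord_convex_midpoint _ x (fun x => fine (f_ext f x))) => //.
exact: chord_convex_pos.
Qed.

(* Any interval of length [e] contains a cell of the grid of mesh [e / 3] that
   avoids 0, and the midpoint gap is monotone for inclusion; so the bound is the
   least gap over finitely many cells. *)
Lemma f_ext_uniform_gap (M e : R) : 0 < e -> exists2 a : R, 0 < a &
  forall x y : R, 0 <= x <= M -> 0 <= y <= M -> e <= `|x - y| ->
  (f_ext f ((x + y) / 2) + f_ext f ((x + y) / 2) + a%:E <= f_ext f x + f_ext f y)%E.
Proof.
move=> e0; pose h := e / 3; have h0 : 0 < h by rewrite /h; lra.
pose g x := fine (f_ext f x).
pose G k := g (k.+1%:R * h) + g (k.+2%:R * h) - 2 * g ((k.+1%:R * h + k.+2%:R * h) / 2).
have G0 k : 0 < G k.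
  have u0 : 0 < k.+1%:R * h by rewrite mulr_gt0.
  have uv : k.+2%:R * h = k.+1%:R * h + h by rewrite -[in LHS]natr1 mulrDl mul1r.
  rewrite /G uv /g /f_ext !gt_eqF/=; [|lra..].
  move: u0; set u := k.+1%:R * h => u0.
  have := f_strict u (u + h) (1 / 2) u0 ltac:(lra) ltac:(by rewrite lt_eqF//; lra) ltac:(lra).
  have -> : 1 / 2 * u + (1 - 1 / 2) * (u + h) = (u + (u + h)) / 2 by field.
  lra.
have [a a0 aG] := finite_lower_bound R G (Num.truncn (M / h)).+1 G0.
exists a => // x y.
wlog xy : x y / x <= y => [hw hx hy|].
  have [xy|/ltW yx] := leP x y; first exact: hw.
  by rewrite (addrC x y) (addeC (f_ext f x)) distrC; apply: hw.
move=> /andP[x0 xM] /andP[y0 yM]; rewrite distrC ger0_norm ?subr_ge0// => exy.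
(* From [k * h <= x < (k + 1) * h] follows [(k + 2) * h <= x + 2 * h < x + e <= y], so the cell of
   index [k] lies between [x] and [y]. Since [x <= M], this index is among the finitely many covered
   by [a]. *)
pose k := Num.truncn (x / h).
have xh0 : 0 <= x / h by rewrite divr_ge0// ltW.
have /andP[kx xk] : k%:R <= x / h < k.+1%:R by rewrite /k truncn_itv.
have kN : (k < (Num.truncn (M / h)).+1)%N.
  by rewrite ltnS /k; apply: le_truncn; rewrite ler_pM2r// invr_gt0.
have {kx}kx : k%:R * h <= x by rewrite -ler_pdivlMr.
have {xk}xk : x <= k.+1%:R * h by rewrite -ler_pdivrMr// ltW.
have k1 : k.+1%:R * h = k%:R * h + h by rewrite -[in LHS]natr1 mulrDl mul1r.
have k2 : k.+2%:R * h = k.+1%:R * h + h by rewrite -[in LHS]natr1 mulrDl mul1r.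
have eh : e = 3 * h by rewrite /h; field.
(* The threshold [b] will be [x] when [x > 0], and 0 when [x = 0] and [f_at0 f] is finite. *)
have key b : chord_convex_from R b g -> b <= x ->
    g ((x + y) / 2) + g ((x + y) / 2) + a <= g x + g y.
  move=> gc bx; have := midpoint_gap_incl R b g x (k.+1%:R * h) (k.+2%:R * h) y gc bx xk.
  move=> /(_ ltac:(lra) ltac:(lra)); have := aG _ kN; rewrite /G; lra.
have fin z : 0 < z -> f_ext f z = (g z)%:E.
  by move=> z0; rewrite /g /f_ext gt_eqF.
have {}y0 : 0 < y by lra.
have m0 : 0 < (x + y) / 2 by lra.
rewrite (fin _ m0) (fin _ y0).
move: x0; rewrite le_eqVlt => /predU1P[x00|x0].
  have -> : f_ext f x = f_at0 f by rewrite /f_ext -x00 eqxx.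
  have := f_at0_ge0.
  case E : (f_at0 f) => [r| |]//= _; last by rewrite leey.
  have -> : r = g x by rewrite /g /f_ext -x00 eqxx E.
  rewrite -!EFinD lee_fin; apply: (key 0); last by rewrite -x00.
  by apply: chord_convex_0; rewrite E.
rewrite (fin _ x0) -!EFinD lee_fin; apply: (key x) => //.
exact: chord_convex_pos.
Qed.

End strictly_convex.

(** * Estimates for a single term of the divergence *)

Section divergence_term.
Context (R : realType) (f : R -> R).
Context (f_strict : strictly_convex_pos f)
  (f_ge0 : forall x : R, 0 < x -> 0 <= f x) (f1 : f 1 = 0)
  (f_infty : fprime_infty f = +oo%E).

Lemma superlinear (K : R) :
  exists2 M : R, 0 < M & forall x : R, M <= x -> K * x <= f x.
Proof.
have cv : (f x / x)%:E @[x --> +oo] --> +oo%E.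
  (* A [lim] that does not exist is a default value other than [+oo], so [f_infty] forces genuine
     convergence. *)
  have [|/dvgP] := pselect (cvg ((f x / x)%:E @[x --> +oo])).
    by rewrite -f_infty.
  by move: f_infty; rewrite /fprime_infty => ->.
have /cvgryPge/(_ K)[M [_ MK]] : f x / x @[x --> +oo] --> +oo by apply/cvgeryP.
(* The 1 makes [x] positive; [M + 1] turns the strict bound [M < x] of the filter at [+oo] into a
   large one. *)
exists (Num.max 1 (M + 1)); first by rewrite lt_max ltr01.
move=> x; rewrite ge_max => /andP[x1 Mx].
have := MK x ltac:(lra); rewrite ler_pdivlMr//; lra.
Qed.

Lemma divergence_term_ge0 (p q : R) :
  0 <= p -> 0 <= q -> (0 <= divergence_term f p q)%E.
Proof.
move=> p0 q0; rewrite /divergence_term; case: ifP => _.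
  by rewrite mule_ge0// f_infty.
by rewrite mule_ge0// f_ext_ge0// divr_ge0.
Qed.

Lemma divergence_term0 (p : R) : 0 <= p -> (divergence_term f p 0 < +oo)%E -> p = 0.
Proof.
rewrite /divergence_term eqxx f_infty le_eqVlt => /predU1P[//|p0].
by rewrite gt0_mulye.
Qed.

(** Split at the density [M] of [superlinear]: below it [K * p <= K * M * q], above it
    [K * (p / q) <= f (p / q)]. For [q = 0] a positive [p] makes the term infinite. *)
Lemma divergence_term_superlinear (K : R) : 0 <= K ->
  exists2 M : R, 0 <= M & forall p q : R, 0 <= p -> 0 <= q ->
    ((K * p)%:E <= (M * q)%:E + divergence_term f p q)%E.
Proof.
move=> K0; have [M M0 MK] := superlinear K.
have KM0 : 0 <= K * M by rewrite mulr_ge0// ltW.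
exists (K * M) => // p q p0; rewrite le_eqVlt => /predU1P[<-|q0].
  rewrite mulr0 add0e; move: p0; rewrite le_eqVlt => /predU1P[<-|p0].
    by rewrite mulr0 divergence_term_ge0.
  by rewrite /divergence_term eqxx f_infty gt0_mulye// leey.
have [pM|/ltW Mp] := leP (p / q) M.
  apply: le_trans (leeDl _ (divergence_term_ge0 _ _ p0 (ltW q0))).
  by rewrite lee_fin -mulrA ler_wpM2l// -ler_pdivrMr.
have pq0 : 0 < p / q by apply: lt_le_trans Mp.
rewrite /divergence_term /f_ext !gt_eqF// -EFinM -EFinD lee_fin.
have : K * (p / q) * q <= f (p / q) * q by rewrite ler_pM2r// MK.
rewrite -mulrA divfK ?gt_eqF//.
have : 0 <= K * M * q by rewrite mulr_ge0// ltW.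
lra.
Qed.

Lemma divergence_term_midpoint_le (p p' q : R) : 0 <= p -> 0 <= p' -> 0 <= q ->
  (divergence_term f ((p + p') / 2) q + divergence_term f ((p + p') / 2) q <=
   divergence_term f p q + divergence_term f p' q)%E.
Proof.
move=> p0 p'0; rewrite le_eqVlt => /predU1P[<-|q0].
  rewrite /divergence_term eqxx f_infty.
  move: p0; rewrite le_eqVlt => /predU1P[<-|p0]; last first.
    by rewrite (@gt0_mulye _ p%:E) ?lte_fin// addye ?leey// gt_eqF//
      (lt_le_trans (ltNyr 0))// mule_ge0.
  move: p'0; rewrite le_eqVlt => /predU1P[<-|p'0]; last first.
    by rewrite (@gt0_mulye _ p'%:E) ?lte_fin// addey ?leey// gt_eqF//
      (lt_le_trans (ltNyr 0))// mule_ge0.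
  by rewrite addr0 mul0r.
have := f_ext_midpoint_le R f f_strict f_ge0 f1 (p / q) (p' / q)
  ltac:(by rewrite divr_ge0// ltW) ltac:(by rewrite divr_ge0// ltW).
have -> : (p / q + p' / q) / 2 = (p + p') / 2 / q by field; rewrite gt_eqF.
rewrite /divergence_term !gt_eqF// -!muleDl//; last 2 first.
- by apply: ge0_adde_def; rewrite inE f_ext_ge0// divr_ge0// ltW.
- by apply: ge0_adde_def; rewrite inE f_ext_ge0// !divr_ge0// ?addr_ge0// ltW.
by move=> h; apply: lee_wpmul2r => //; rewrite lee_fin ltW.
Qed.

Lemma divergence_term_uniform_gap (q e : R) : 0 < q -> 0 < e ->
  exists2 a : R, 0 < a & forall p p' : R, 0 <= p <= 1 -> 0 <= p' <= 1 -> e <= `|p - p'| ->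
  (divergence_term f ((p + p') / 2) q + divergence_term f ((p + p') / 2) q + a%:E <=
   divergence_term f p q + divergence_term f p' q)%E.
Proof.
move=> q0 e0.
(* Masses in [0, 1] at distance [e] have densities in [[0, 1 / q]] at distance [e / q]; the gap is
   then scaled back by [q]. *)
have [a a0 ha] := f_ext_uniform_gap R f f_strict f_ge0 f1 (1 / q) (e / q) (divr_gt0 e0 q0).
exists (a * q); first exact: mulr_gt0.
move=> p p' /andP[p0 p1] /andP[p'0 p'1] epp.
have := ha (p / q) (p' / q).
rewrite !divr_ge0 ?(ltW q0)//= !ler_pM2r ?invr_gt0// -mulrBl normrM.
rewrite (gtr0_norm (x := q^-1)) ?invr_gt0// ler_pM2r ?invr_gt0//.
move=> /(_ p1 p'1 epp).
have -> : (p / q + p' / q) / 2 = (p + p') / 2 / q by field; rewrite gt_eqF.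
rewrite /divergence_term !gt_eqF// EFinM => h.
have m0 : (0 <= f_ext f ((p + p') / 2 / q))%E.
  by rewrite f_ext_ge0// !divr_ge0// ?addr_ge0// ltW.
have q0' := ltW q0.
rewrite -!ge0_muleDl ?f_ext_ge0 ?adde_ge0 ?divr_ge0 ?addr_ge0 ?lee_fin ?(ltW a0)//.
by apply: lee_wpmul2r.
Qed.

End divergence_term.

(** * Measures on a countable discrete space *)

Section discrete_measures.
Context (d : measure_display) (T : measurableType d) (R : realType).
Context (hT : discrete_countable T).

Lemma discrete_measurable (A : set T) : measurable A.
Proof. by case: hT. Qed.

(** The pieces are the fibres in [A] of an injection into [nat], which puts countable additivity in
    sequence form. Empty pieces occur because the injection need not be onto. *)
Lemma discrete_partition (A : set T) : exists F : nat -> set T,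
  [/\ trivIset setT F, A = \bigcup_n F n & forall n, F n = set0 \/ exists i, F n = [set i]].
Proof.
have /countable_injP[e einj] := hT.1.
exists (fun n => A `&` [set x | e x = n]); split.
- by apply/trivIsetP => i j _ _ /eqP ij; apply/seteqP; split => // x/= [[_ xi] [_ xj]]; apply: ij; rewrite -xi.
- apply/seteqP; split => [x Ax|x [n _ []//]]; by exists (e x).
- move=> n; have [->|/set0P[x [Ax xn]]] := eqVneq (A `&` [set x | e x = n]) set0; first by left.
  right; exists x; apply/seteqP; split => [y [_ yn]|y /= ->//].
  by apply: einj; rewrite ?inE// xn.
Qed.

Lemma discrete_esum (mu : {measure set T -> \bar R}) (A : set T) :
  mu A = \esum_(i in A) mu [set i].
Proof.
have [F [tF -> F1]] := discrete_partition A.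
rewrite nneseries_sum_bigcup// measure_bigcup//=; last by move=> *; exact: discrete_measurable.
rewrite (eq_eseriesl (Q := xpredT)); last by move=> n; rewrite in_setT.
apply: eq_eseriesr => n _; case: (F1 n) => [->|[i ->]].
  by rewrite measure0 esum_set0.
by rewrite esum_set1.
Qed.

(** Uniqueness is Leibniz equality of packed structures. Once the set functions agree, the remaining
    fields are proofs, identified by proof irrelevance. *)
Lemma eq_probability (P P' : probability T R) :
  (forall i, P [set i] = P' [set i]) -> P = P'.
Proof.
move=> PP'; have : (P : set T -> \bar R) = P'.
  by apply/funext => A; rewrite !discrete_esum; apply: eq_esum => i _; exact: PP'.
case: P PP' => p [[a1 a2] [a3] [a4] [a5] [a6] [a7] [a8]].
case: P' => p' [[b1 b2] [b3] [b4] [b5] [b6] [b7] [b8]] /= _ pp'; subst p'.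
have ? := Prop_irrelevance a1 b1; have ? := Prop_irrelevance a2 b2; subst b1 b2.
by rewrite (Prop_irrelevance a3 b3) (Prop_irrelevance a4 b4)
  (Prop_irrelevance a5 b5) (Prop_irrelevance a6 b6) (Prop_irrelevance a7 b7)
  (Prop_irrelevance a8 b8).
Qed.

End discrete_measures.

(** * Probabilities built from point masses *)

Section mass_measure.
Context (d : measure_display) (T : measurableType d) (R : realType).
Context (p : T -> R) (p0 : forall i, 0 <= p i)
  (p1 : \esum_(i in [set: T]) (p i)%:E = 1%E).

Definition mass_measure (A : set T) : \bar R := \esum_(i in A) (p i)%:E.

Let mass_measure0 : mass_measure set0 = 0%E.
Proof. exact: esum_set0. Qed.

Let mass_measure_ge0 A : (0 <= mass_measure A)%E.
Proof. by apply: esum_ge0 => i _; rewrite lee_fin. Qed.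

Let mass_measure_sigma : semi_sigma_additive mass_measure.
Proof.
move=> F mF tF mUF; rewrite /mass_measure nneseries_sum_bigcup//.
apply: is_cvg_ereal_nneg_natsum => n _; exact: mass_measure_ge0.
Qed.

HB.instance Definition _ := isMeasure.Build d T R mass_measure
  mass_measure0 mass_measure_ge0 mass_measure_sigma.

HB.instance Definition _ := Measure_isProbability.Build d T R mass_measure p1.

Lemma ex_probability_mass :
  exists P : probability T R, forall i, P [set i] = (p i)%:E.
Proof.
exists (mass_measure : probability T R) => i.
by rewrite /= /mass_measure esum_set1 ?lee_fin.
Qed.

End mass_measure.

Lemma cvgn_lt_shift (R : realType) (u : nat -> \bar R) (l : \bar R) (e : R) :
  l \is a fin_num -> 0 < e -> u n @[n --> \oo] --> l ->
  \forall n \near \oo, (u n < l + e%:E)%E.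
Proof.
case: l => // r _ e0 ul; apply: (ul [set y | (y < (r + e)%:E)%E]).
by apply: (@nbhs_open_ereal_lt _ r (fun x => x + e)); rewrite ltrDl.
Qed.

Lemma le_esumT (R : realType) (T : choiceType) (A : set T) (a : T -> \bar R) :
  (forall i, (0 <= a i)%E) -> (\esum_(i in A) a i <= \esum_(i in [set: T]) a i)%E.
Proof. by move=> a0; rewrite esum_mkcond; apply: le_esum => i _; case: ifP. Qed.

(** * Nearly optimal members of [C] *)

Section projection.
Context (R : realType) (d : measure_display) (T : measurableType d).
Context (hT : discrete_countable T) (f : R -> R).
Context (f_strict : strictly_convex_pos f)
  (f_ge0 : forall x : R, 0 < x -> 0 <= f x) (f1 : f 1 = 0)
  (f_infty : fprime_infty f = +oo%E).
Context (C : set (probability T R)) (hC : convex_probabilities C)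
  (Q : probability T R) (hfin : (fdivergence_set f C Q < +oo)%E).

Local Notation mass P i := (fine (P [set i])).
Local Notation term P i := (divergence_term f (mass P i) (mass Q i)).
Local Notation D := (fdivergence_set f C Q).

Let massE (P : probability T R) i : P [set i] = (mass P i)%:E.
Proof. by rewrite fineK// fin_num_measure//; exact: discrete_measurable. Qed.

Let mass_itv (P : probability T R) i : 0 <= mass P i <= 1.
Proof.
rewrite -!lee_fin -massE measure_ge0 probability_le1//.
exact: discrete_measurable.
Qed.

Let mass_ge0 (P : probability T R) i : 0 <= mass P i.
Proof. by case/andP: (mass_itv P i). Qed.

Let term_ge0 (P : probability T R) i : (0 <= term P i)%E.
Proof. exact: divergence_term_ge0. Qed.

Let fdivergence_ge0 (P : probability T R) : (0 <= fdivergence f P Q)%E.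
Proof. by apply: esum_ge0 => i _; exact: term_ge0. Qed.

Let D_fin : D \is a fin_num.
Proof.
rewrite ge0_fin_numE//; apply: le_ereal_inf_tmp => _ [P _ <-].
exact: fdivergence_ge0.
Qed.

Let term_le (P : probability T R) i : (term P i <= fdivergence f P Q)%E.
Proof.
have -> : term P i = \esum_(j in [set i]) term P j by rewrite esum_set1.
exact: le_esumT.
Qed.

(** Absolute continuity with respect to [Q]: since [f'(oo) = oo], one charged [Q]-null point already
    makes the divergence infinite. *)
Lemma finite_divergence_null (P : probability T R) i :
  (fdivergence f P Q < +oo)%E -> mass Q i = 0 -> mass P i = 0.
Proof.
move=> h q0; apply: (@divergence_term0 _ f f_infty) => //.
by have := term_le P i; rewrite q0 => /le_lt_trans; apply.
Qed.

Let ex_midpoint (P P' : probability T R) : C P -> C P' ->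
  exists2 P'' : probability T R, C P'' &
    forall i, mass P'' i = (mass P i + mass P' i) / 2.
Proof.
move=> CP CP'; have [|P'' CP'' E] := hC P P' (1 / 2) CP CP'; first by lra.
exists P'' => // i; have := E _ (discrete_measurable _ _ hT [set i]).
rewrite (massE P) (massE P') => ->; rewrite -!EFinM -EFinD /=.
by field.
Qed.

(** If the masses at [i] were [e] apart, the midpoint of [P] and [P'] would have divergence below
    the infimum. At [Q]-null points both masses vanish. *)
Lemma near_optimal_close (i : T) (e : R) : 0 < e -> exists2 del : R, 0 < del &
  forall P P' : probability T R, C P -> C P' ->
    (fdivergence f P Q < D + del%:E)%E -> (fdivergence f P' Q < D + del%:E)%E ->
    `|mass P i - mass P' i| < e.
Proof.
move=> e0; have := mass_ge0 Q i; rewrite le_eqVlt => /predU1P[/esym q0|q0].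
  exists 1 => // P P' _ _ hP hP'.
  have fin (P0 : probability T R) : (fdivergence f P0 Q < D + 1%:E)%E ->
      (fdivergence f P0 Q < +oo)%E.
    by move=> h; apply: lt_trans h _; rewrite lte_add_pinfty// ltry.
  rewrite (finite_divergence_null P i (fin _ hP) q0).
  by rewrite (finite_divergence_null P' i (fin _ hP') q0) subrr normr0.
have [a a0 ha] := divergence_term_uniform_gap _ f f_strict f_ge0 f1 _ e q0 e0.
(* The slacks of [P] and [P'] then add up to exactly the gap [a]. *)
exists (a / 2) => [|P P' CP CP' hP hP']; first by rewrite divr_gt0.
rewrite ltNge; apply/negP => eP.
have [P'' CP'' mE] := ex_midpoint P P' CP CP'.
have DP'' : (D <= fdivergence f P'' Q)%E by apply: ereal_inf_lbound; exists P''.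
have : (fdivergence f P'' Q + fdivergence f P'' Q + a%:E <=
        fdivergence f P Q + fdivergence f P' Q)%E.
  (* The gap is a sum supported at [i], so the comparison is termwise: uniform gap at [i], plain
     midpoint convexity elsewhere. *)
  have -> : a%:E = \esum_(j in [set i]) a%:E by rewrite esum_set1// lee_fin ltW.
  have a_ge0 j : (0 <= if j \in [set i] then a%:E else 0)%E.
    by case: ifP => // _; rewrite lee_fin ltW.
  rewrite (esum_mkcond [set i]) /fdivergence -!esumD;
    try by move=> j _; rewrite ?adde_ge0 ?term_ge0 ?a_ge0.
  apply: le_esum => j _; case: ifPn => [|_]; last first.
    by rewrite adde0 !mE; apply: divergence_term_midpoint_le;
      rewrite ?mass_ge0.
  by rewrite inE /= => ->; rewrite !mE; apply: ha; rewrite ?mass_itv.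
apply/negP; rewrite -ltNge; apply: (lt_le_trans (lteD hP hP')).
apply: (@le_trans _ _ (D + D + a%:E)%E); last by rewrite leeD2r// leeD.
case: (D) D_fin => //= r _; rewrite -!EFinD lee_fin; lra.
Qed.

(** * Tightness under bounded divergence *)

Let fdivergence_superlinear (K : R) : 0 <= K -> exists2 M : R, 0 <= M &
  forall (P : probability T R) A,
    (K%:E * P A <= M%:E * Q A + fdivergence f P Q)%E.
Proof.
move=> K0; have [M M0 h] := divergence_term_superlinear _ f f_strict f_ge0 f1 f_infty K K0.
exists M => // P A.
have scaleE (c : R) (c0 : 0 <= c) (mu : probability T R) :
    (c%:E * mu A = \esum_(i in A) (c * mass mu i)%:E)%E.
  (* The multiple [c * mu] is itself a measure, hence a sum over points. *)
  rewrite -[LHS]/(mscale (NngNum c0) mu A) (discrete_esum _ _ _ hT).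
  by apply: eq_esum => i _; rewrite EFinM -massE.
rewrite !scaleE//; apply: (@le_trans _ _ (\esum_(i in A) (M * mass Q i)%:E +
    \esum_(i in A) term P i)%E); last first.
  by rewrite leeD2l// le_esumT.
rewrite -esumD//; last by move=> i _; rewrite lee_fin mulr_ge0.
by apply: le_esum => i _; exact: h.
Qed.

(** A finite [X] carrying most of [Q] works for all [P] at once, because [M] in the superlinear
    bound does not depend on [P]. *)
Lemma bounded_divergence_tight (B e : R) : 0 <= B -> 0 < e ->
  exists2 X : set T, finite_set X &
    forall P : probability T R, (fdivergence f P Q <= B%:E)%E -> ((1 - e)%:E <= P X)%E.
Proof.
move=> B0 e0.
have B1 : 0 < B + 1 by lra.
(* Off [X], [M] times the [Q]-mass is at most [B + 1], so [K] times the [P]-mass is at most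
   [2 * (B + 1)]; this [K] makes that mass at most [e]. The added 1s cover [B = 0] and [M = 0]. *)
have K0 : 0 <= 2 * (B + 1) / e by rewrite divr_ge0 ?mulr_ge0 ?ltW.
have [M M0 h] := fdivergence_superlinear _ K0.
have eta0 : 0 < (B + 1) / (M + 1) by rewrite divr_gt0//; lra.
have : ((1 - (B + 1) / (M + 1))%:E < Q setT)%E.
  by rewrite probability_setT lte_fin; lra.
rewrite (discrete_esum _ _ _ hT) => /ereal_sup_gt[_ [X [finX _] <-]].
rewrite -esum_fset// -(discrete_esum _ _ _ hT) => QX.
exists X => // P DP.
have mX := discrete_measurable _ _ hT X.
have := h P (~` X); rewrite !probability_setC//.
have finE (P' : probability T R) : P' X = (fine (P' X))%:E.
  by rewrite fineK// fin_num_measure.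
have {}QX : 1 - (B + 1) / (M + 1) < fine (Q X) by rewrite -lte_fin -finE.
rewrite (finE P) (finE Q) -!EFinB -!EFinM lee_fin.
move: QX; set x := fine (P X); set y := fine (Q X) => xy /le_trans => /(_ _ (leeD2l _ DP)).
rewrite -EFinD lee_fin => hh.
have M1 : 0 < M + 1 by lra.
have hy : M * (1 - y) <= B + 1.
  have : (1 - y) * (M + 1) <= B + 1 by rewrite -ler_pdivlMr//; lra.
  have : y <= 1 by rewrite -lee_fin -finE probability_le1.
  lra.
have : 2 * (B + 1) / e * (1 - x) <= 2 * (B + 1) by lra.
by rewrite mulrAC ler_pdivrMr// ler_pM2l; lra.
Qed.

(** * Asymptotically optimal sequences and their limit *)

(** Uniqueness rests on this too: without such a sequence every probability would vacuously be a
    projection. *)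
Lemma ex_asymptotically_optimal :
  exists P_ : nat -> probability T R, asymptotically_optimal f C Q P_.
Proof.
have /choice[P_ hP] : forall n : nat, exists P : probability T R,
    C P /\ (fdivergence f P Q < D + (harmonic n)%:E)%E.
  move=> n; have /ereal_inf_lt[_ [P CP <-] hP] : (D < D + (harmonic n)%:E)%E.
    by rewrite lteDl// lte_fin /harmonic invr_gt0.
  by exists P.
exists P_; split => [n|]; first by case: (hP n).
apply: (@squeeze_cvge _ _ _ _ (cst D) _ (fun n => D + (harmonic n)%:E)%E).
- apply: nearW => n; case: (hP n) => CP /ltW ->; rewrite andbT.
  by apply: ereal_inf_lbound; exists (P_ n).
- exact: cvg_cst.
- rewrite -[X in _ --> X]adde0; apply: cvgeD => //.
  + by rewrite fin_num_adde_defr.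
  + exact: cvg_cst.
  + exact: cvge_harmonic.
Qed.

(** One reference sequence [P0] is Cauchy at each point and defines [p]. A late term of [P0] is
    close to this limit and also to the late terms of any other optimal sequence. *)
Lemma asymptotically_optimal_cvg : exists p : T -> R,
  forall P_, asymptotically_optimal f C Q P_ ->
    forall i, P_ n [set i] @[n --> \oo] --> (p i)%:E.
Proof.
have [P0 [CP0 cP0]] := ex_asymptotically_optimal.
have cv i : cvgn (fun n => mass (P0 n) i).
  apply/cauchy_cvgP/cauchy_exP => e e0.
  have [del del0 h] := near_optimal_close i e e0.
  have [N _ hN] := cvgn_lt_shift _ _ _ _ D_fin del0 cP0.
  exists (mass (P0 N) i), N => // n Nn; apply: h => //; first exact: hN (leqnn N).
  exact: hN.
exists (fun i => limn (fun n => mass (P0 n) i)) => P_ [CP cP] i.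
apply: cvg_EFin; first by apply: nearW => n; rewrite massE.
apply/cvgrPdist_lt => e e0.
have e20 : 0 < e / 2 by rewrite divr_gt0.
have [del del0 h] := near_optimal_close i (e / 2) e20.
have := cv i => /cvgrPdist_lt/(_ _ e20) c0.
near \oo => N.
near=> n.
apply: le_lt_trans (ler_distD (mass (P0 N) i) _ _) _.
rewrite [ltRHS](splitr e); apply: ltrD; first by near: N.
apply: h => //; first by near: N; apply: cvgn_lt_shift.
by near: n; apply: cvgn_lt_shift.
Unshelve. all: by end_near. Qed.

Lemma limit_ge0 (p : T -> R) (P_ : nat -> probability T R) :
  (forall i, P_ n [set i] @[n --> \oo] --> (p i)%:E) -> forall i, 0 <= p i.
Proof.
move=> cvp i; rewrite -lee_fin -(cvg_lim (@ereal_hausdorff R) (cvp i)).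
apply: lime_ge; first by apply/cvg_ex; exists (p i)%:E.
by apply: nearW => n; exact: measure_ge0.
Qed.

(** Eventually the divergence is below [D + 1], hence finite, and [P_ n] does not charge [Q]-null
    points. *)
Lemma limit_null (p : T -> R) (P_ : nat -> probability T R) :
  asymptotically_optimal f C Q P_ ->
  (forall i, P_ n [set i] @[n --> \oo] --> (p i)%:E) ->
  forall i, Q [set i] = 0%E -> p i = 0.
Proof.
move=> [CP cP] cvp i Qi; apply: EFin_inj.
rewrite -(cvg_lim (@ereal_hausdorff R) (cvp i)); apply/cvg_lim => //.
apply: cvg_near_cst; have := cvgn_lt_shift _ _ _ 1 D_fin ltr01 cP.
apply: filterS => n h; rewrite massE finite_divergence_null ?Qi//.
by apply: lt_trans h _; rewrite lte_add_pinfty// ltry.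
Qed.

(** Finite partial sums are limits of [P_ n X <= 1], which gives one inequality. Tightness keeps
    some such sum above [1 - e], which gives the other. *)
Lemma limit_total_mass (p : T -> R) (P_ : nat -> probability T R) :
  asymptotically_optimal f C Q P_ ->
  (forall i, P_ n [set i] @[n --> \oo] --> (p i)%:E) ->
  \esum_(i in [set: T]) (p i)%:E = 1%E.
Proof.
move=> [CP cP] cvp.
have p0 := limit_ge0 p P_ cvp.
have cvX (X : set T) : finite_set X ->
    P_ n X @[n --> \oo] --> (\sum_(i \in X) (p i)%:E)%E.
  move=> finX; rewrite fsbig_finite//=.
  have -> : (fun n => P_ n X) = (fun n => \sum_(i <- finmap.enum_fset (fset_set X)) P_ n [set i])%E.
    apply/funext => n.
    by rewrite (discrete_esum _ _ _ hT) esum_fset// fsbig_finite.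
  apply: cvg_nnesum => i _; last exact: cvp.
  by apply: nearW => n; exact: measure_ge0.
have limX X (finX : finite_set X) := cvg_lim (@ereal_hausdorff R) (cvX X finX).
have is_cvgX X (finX : finite_set X) : cvgn (fun n => P_ n X).
  by apply/cvg_ex; eexists; exact: cvX finX.
apply/eqP; rewrite eq_le; apply/andP; split.
  apply: ge_ereal_sup => _ [X [finX _] <-]; rewrite -limX//.
  apply: lime_le; first exact: is_cvgX.
  by apply: nearW => n; apply: probability_le1; exact: discrete_measurable.
apply/lee_addgt0Pr => e e0; rewrite -leeBlDr// -EFinB.
have B0 : 0 <= fine D + 1.
  by rewrite addr_ge0// fine_ge0//; apply: le_ereal_inf_tmp => _ [P _ <-].
have [X finX hX] := bounded_divergence_tight _ e B0 e0.
apply: (@le_trans _ _ (\sum_(i \in X) (p i)%:E)%E); last first.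
  by apply: ereal_sup_ubound; exists X.
rewrite -limX//; apply: lime_ge; first exact: is_cvgX.
have := cvgn_lt_shift _ _ _ 1 D_fin ltr01 cP.
apply: filterS => n h; apply: hX; apply: ltW.
by rewrite EFinD fineK.
Qed.

End projection.

Theorem theorem7 (R : realType) (d : measure_display) (T : measurableType d)
    (hT : discrete_countable T)
    (f : R -> R)
    (f_strict : strictly_convex_pos f)
    (f_ge0 : forall x : R, 0 < x -> 0 <= f x)
    (f1 : f 1 = 0)
    (f_infty : fprime_infty f = +oo%E)
    (C : set (probability T R)) (hC : convex_probabilities C)
    (Q : probability T R)
    (hfin : (fdivergence_set f C Q < +oo)%E) :
  exists! Qstar : probability T R, is_projection f C Q Qstar.
Proof.
have [p cvp] := asymptotically_optimal_cvg _ _ _ hT f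
  f_strict f_ge0 f1 f_infty C hC Q hfin.
have [P0 optP0] := ex_asymptotically_optimal _ _ _ hT f
  f_strict f_ge0 f1 f_infty C Q hfin.
have p0 := limit_ge0 _ _ _ p P0 (cvp _ optP0).
have psum := limit_total_mass _ _ _ hT f f_strict f_ge0 f1 f_infty C Q hfin
  p P0 optP0 (cvp _ optP0).
have [Qs Qsp] := ex_probability_mass _ _ _ p p0 psum.
exists Qs; split => [P_ optP|Q' projQ'].
  by apply: aeW => i; have := cvp _ optP i; rewrite -Qsp.
have mA := discrete_measurable _ _ hT.
have QsQ' i : Q [set i] != 0%E -> Qs [set i] = Q' [set i].
  (* If convergence failed at [i], the point would lie in the null set [N], against [Q [set i] !=
     0]. *)
  move=> Qi; have [N [mN QN hN]] := projQ' _ optP0.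
  have cvQ' : P0 n [set i] @[n --> \oo] --> Q' [set i].
    apply: contrapT => /hN Ni; move/eqP: Qi; apply.
    apply/eqP; rewrite eq_le measure_ge0 andbT -QN; apply: le_measure;
      rewrite ?inE// => _ ->; exact: Ni.
  rewrite Qsp; apply: cvg_unique (cvp _ optP0 i) cvQ'; exact: ereal_hausdorff.
(* Almost everywhere convergence says nothing about [Q'] on [Z]. Agreement off [Z] and equal total
   mass 1 give [Q' Z = Qs Z = 0]. *)
pose Z := [set i | Q [set i] = 0%E].
have QsZ i : Z i -> Qs [set i] = 0%E.
  move=> Zi; rewrite Qsp.
  by rewrite (limit_null _ _ _ hT f f_strict f_ge0 f1 f_infty C Q hfin
    p P0 optP0 (cvp _ optP0) i Zi).
have QsQ'Z : Qs Z = Q' Z.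
  rewrite -(setCK Z) !(probability_setC _ (mA (~` Z))); congr (1 - _)%E.
  rewrite !(discrete_esum _ _ _ hT (_ : {measure set T -> \bar R}) (~` Z)).
  by apply: eq_esum => i /eqP; exact: QsQ'.
apply: eq_probability => // i; have [Zi|/QsQ'//] := eqVneq (Q [set i]) 0%E.
rewrite QsZ//; apply/esym/eqP; rewrite eq_le measure_ge0 andbT.
have <- : Q' Z = 0%E.
  by rewrite -QsQ'Z (discrete_esum _ _ _ hT); apply: esum1.
by apply: le_measure; rewrite ?inE// => _ ->.
Qed.
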